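(* Let $M$ be a finite monoid. The following are equivalent: (1) $M$ is totally ordered; (2) for every edge selector $P\subseteq M^3$ and every $d\in\mathbb{N}$, the class of (unlabelled) downcastings $\{\mathrm{dc}(\mathcal{G}):\mathcal{G}\in\mathrm{Reg}_d\}$ is $\infty$-well-quasi-ordered for the induced subgraph relation; (3) for every edge selector $P\subseteq M^3$ and every $d\in\mathbb{N}$, that class is $2$-well-quasi-ordered.
   Context: For $m$ in a monoid $M$, $J(m)=\{xmy:x,y\in M\}$; $M$ is totally ordered if for all $a,b$, $J(ab)=J(a)$ or $J(ab)=J(b)$. $e\in M$ is idempotent if $e^2=e$. A monoid-labelled graph over $M$ is a tuple $\mathcal{G}=(m,V,E,\lambda)$ with $m\in M$ (the evaluation of $\mathcal{G}$), $V$ a finite vertex set, $E\colon V\times V\to(M^2\to\{\top,\bot\})$ and $\lambda\colon V\to M^2$ such that $\lambda(x)=(l_x,r_x)$ satisfies $l_xr_x=m$ for all $x$. The downcasting $\mathrm{dc}(\mathcal{G})$ is the graph on $V$ in which distinct $x,y$ are adjacent iff $E(x,y)(1_M,1_M)=\top$. An edge selector is a set $P\subseteq M^3$. The binary product (w.r.t. $P$) $\mathcal{G}_1\odot\mathcal{G}_2$ of $\mathcal{G}_i=(m_i,V_i,E_i,\lambda_i)$ has vertex set $V_1\sqcup V_2$, evaluation $m_1m_2$, label $(l_x,r_xm_2)$ for $x\in V_1$ with $\lambda_1(x)=(l_x,r_x)$, label $(m_1l_y,r_y)$ for $y\in V_2$ with $\lambda_2(y)=(l_y,r_y)$, edge function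 $E_1(x,x')(s,m_2t)$ on $V_1$, $E_2(y,y')(sm_1,t)$ on $V_2$, and for $x\in V_1,y\in V_2$: $E(x,y)(s,t)=E(y,x)(s,t)=\top$ iff $(sl_x,r_xl_y,r_yt)\in P$. This product is associative. For a finite nonempty sequence $\mathcal{G}_1,\dots,\mathcal{G}_n$ all evaluating to the same idempotent $e$, the idempotent product is $\mathcal{G}_1\odot\cdots\odot\mathcal{G}_n$. $\mathrm{Reg}_0$ is the class of monoid-labelled graphs with one vertex; $\mathrm{Reg}_{k+1}$ consists of all $\mathcal{G}_1\odot\mathcal{G}_2$ with $\mathcal{G}_1,\mathcal{G}_2\in\mathrm{Reg}_k$ and all idempotent products of finite nonempty sequences in $\mathrm{Reg}_k$ evaluating to a common idempotent. Graph embeddings are injective maps with $\{h(u),h(v)\}$ an edge iff $\{u,v\}$ is. A class $\mathcal{C}$ of graphs is $k$-well-quasi-ordered if for every finite $X$ with $|X|\le k$, the graphs in $\mathcal{C}$ with vertex labellings into $X$ are well-quasi-ordered by label-preserving embeddings; $\infty$-well-quasi-ordered if this holds for every finite $X$. *)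

(* Defs.v *)
From mathcomp Require Import all_boot.
Set Implicit Arguments. Unset Strict Implicit. Unset Printing Implicit Defensive.

Section MonoidLabelledGraphs.
Variable M : finType.
Variable mul : M -> M -> M.

Definition Jideal (m : M) : {set M} := [set mul (mul x m) y | x : M, y : M].

Definition totally_ordered : Prop :=
  forall a b : M, Jideal (mul a b) = Jideal a \/ Jideal (mul a b) = Jideal b.

(* A monoid-labelled graph; the finite vertex set is 'I_mlg_n.
   mlg_E x y s t = E(x,y)(s,t),  mlg_lab x = lambda(x) = (l_x, r_x). *)
Record mlgraph := MLGraph {
  mlg_eval : M;
  mlg_n : nat;
  mlg_E : 'I_mlg_n -> 'I_mlg_n -> M -> M -> bool;
  mlg_lab : 'I_mlg_n -> M * M }.
Arguments mlg_E : clear implicits.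
Arguments mlg_lab : clear implicits.

Definition mlg_wf (G : mlgraph) : Prop :=
  forall x, mul (mlg_lab G x).1 (mlg_lab G x).2 = mlg_eval G.

Definition mprod (P : {set M * M * M}) (G1 G2 : mlgraph) : mlgraph :=
  let m1 := mlg_eval G1 in
  let m2 := mlg_eval G2 in
  @MLGraph (mul m1 m2) (mlg_n G1 + mlg_n G2)
    (fun x y s t =>
       match split x, split y with
       | inl x, inl x' => mlg_E G1 x x' s (mul m2 t)
       | inr y, inr y' => mlg_E G2 y y' (mul s m1) t
       | inl x, inr y | inr y, inl x =>
           (mul s (mlg_lab G1 x).1, mul (mlg_lab G1 x).2 (mlg_lab G2 y).1,
            mul (mlg_lab G2 y).2 t) \in P
       end)
    (fun x => match split x with
              | inl x => ((mlg_lab G1 x).1, mul (mlg_lab G1 x).2 m2)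
              | inr y => (mul m1 (mlg_lab G2 y).1, (mlg_lab G2 y).2)
              end).

(* Reg_d; the idempotent product of G :: Gs is G (.) G_1 (.) ... (.) G_k
   (bracketed to the left; the product is associative). *)
Inductive Reg (P : {set M * M * M}) : nat -> mlgraph -> Prop :=
| Reg_base (G : mlgraph) :
    mlg_n G = 1 -> mlg_wf G -> Reg P 0 G
| Reg_bin (k : nat) (G1 G2 : mlgraph) :
    Reg P k G1 -> Reg P k G2 -> Reg P k.+1 (mprod P G1 G2)
| Reg_idem (k : nat) (e : M) (G : mlgraph) (Gs : seq mlgraph) :
    mul e e = e ->
    Reg P k G -> mlg_eval G = e ->
    (forall i, (i < size Gs)%N -> Reg P k (nth G Gs i)) ->
    (forall i, (i < size Gs)%N -> mlg_eval (nth G Gs i) = e) ->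
    Reg P k.+1 (foldl (mprod P) G Gs).

End MonoidLabelledGraphs.

Record sgraph := SGraph { sg_n : nat; sg_adj : rel 'I_sg_n }.

Definition dc (M : finType) (one : M) (G : mlgraph M) : sgraph :=
  @SGraph (mlg_n G) (fun x y => (x != y) && @mlg_E M G x y one one).

Definition lembeds (X : Type) (g h : sgraph)
    (lg : 'I_(sg_n g) -> X) (lh : 'I_(sg_n h) -> X) : Prop :=
  exists f : 'I_(sg_n g) -> 'I_(sg_n h),
    [/\ injective f,
        (forall u v, sg_adj (f u) (f v) = sg_adj u v) &
        (forall u, lh (f u) = lg u)].

Definition wqo_labelled (C : sgraph -> Prop) (X : finType) : Prop :=
  forall (g : nat -> sgraph) (lab : forall i, 'I_(sg_n (g i)) -> X),
    (forall i, C (g i)) ->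
    exists i j, (i < j)%N /\ lembeds (lab i) (lab j).

Definition k_wqo (k : nat) (C : sgraph -> Prop) : Prop :=
  forall X : finType, (#|X| <= k)%N -> wqo_labelled C X.

Definition inf_wqo (C : sgraph -> Prop) : Prop :=
  forall X : finType, wqo_labelled C X.

Definition dc_Reg_class (M : finType) (mul : M -> M -> M) (one : M)
    (P : {set M * M * M}) (d : nat) : sgraph -> Prop :=
  fun g => exists G, Reg mul P d G /\ g = dc one G.

(* Main.v *)
(** A graph in [Reg_d] is determined by a word over [M * M], with an edge
    between two vertices given by the values of the prefix, infix and suffix
    that they delimit.

    If [M] is totally ordered, words over elements and coloured vertices are
    well-quasi-ordered by erasing vertices while keeping all these values.
    Induction on the least size [k] of an ideal [J(m)] of a letter: cut the word
    at the letters [c] with [#|J(c)| = k] and apply Higman's lemma to the blocks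
    [(c, H, s)], with [s] the value of what follows the block.  If an inserted
    factor of value [y] is followed by [c] then [y c q = c q], where [q] is the
    value of what follows [c]; as [J(c q) = J(c)], stability gives [c = c q t],
    hence [y c = c].

    If [J(ab)] differs from [J(a)] and [J(b)], repeat a block [a b a b .. 1 1]
    whose value is idempotent, joining two vertices iff the infix between them
    is outside [J(ab)].  Consecutive vertices are adjacent, and adjacent vertices
    lie in the same or in neighbouring blocks, so with the first and last vertex
    coloured no such graph embeds in one with many more blocks. *)

Require Import Defs.
From mathcomp Require Import all_boot.
From mathcomp Require Import boolp zify.
Set Implicit Arguments. Unset Strict Implicit. Unset Printing Implicit Defensive.

(** * Well-quasi-orders and Higman's lemma *)

Section WellQuasiOrders.

Definition wqo_on T (A : pred T) (R : T -> T -> Prop) : Prop :=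
  forall g : nat -> T, (forall i, A (g i)) ->
  exists i j, i < j /\ R (g i) (g j).

Definition trans_rel T (R : T -> T -> Prop) : Prop :=
  forall x y z, R x y -> R y z -> R x z.

(** Terms with no later term above them have bounded index, since otherwise they would form a
    sequence without a good pair. Past the bound, moving repeatedly to a later larger term gives the
    subsequence. *)
Lemma wqo_on_mono T (A : pred T) (R : T -> T -> Prop) (g : nat -> T) :
  wqo_on A R -> trans_rel R -> (forall i, A (g i)) ->
  exists phi : nat -> nat, (forall i j, i < j -> phi i < phi j) /\
    (forall i j, i < j -> R (g (phi i)) (g (phi j))).
Proof.
move=> wqoR trR gA.
have [N live] : exists N, forall i, N <= i -> exists j, i < j /\ R (g i) (g j).
  apply: contrapT => none.
  have dead N : exists i, N <= i /\ forall j, i < j -> ~ R (g i) (g j).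
    apply: contrapT => h; apply: none; exists N => i Ni.
    apply: contrapT => h'; apply: h; exists i; split=> // j ij Rij.
    by apply: h'; exists j.
  have [h hP] := choice dead.
  pose psi n := iter n (fun x => h x.+1) (h 0).
  have psi_dead n j : psi n < j -> ~ R (g (psi n)) (g j).
    by case: n => [|n]; apply: (hP _).2.
  have psi_lt i j : i < j -> psi i < psi j.
    apply: (@homo_ltn _ psi (fun x y => x < y)) => [y x z|{}i].
      exact: ltn_trans.
    exact: (hP (psi i).+1).1.
  have [i [j [ij Rij]]] := wqoR (g \o psi) (fun i => gA (psi i)).
  exact: psi_dead (psi_lt _ _ ij) Rij.
have /choice[s sP] i : exists j, N <= i -> i < j /\ R (g i) (g j).
  by case: (leqP N i) => [/live[j ?]|_]; [exists j | exists 0].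
pose phi n := iter n s N.
have phi_ge n : N <= phi n.
  elim: n => //= n IHn; exact: leq_trans IHn (ltnW (sP _ IHn).1).
exists phi; split.
  apply: (@homo_ltn _ phi (fun x y => x < y)) => [y x z|i].
    exact: ltn_trans.
  exact: (sP _ (phi_ge i)).1.
apply: (@homo_ltn _ (g \o phi) R) => [y x z|i]; first exact: trR.
exact: (sP _ (phi_ge i)).2.
Qed.

Lemma wqo_on_eq (F : finType) (A : pred F) : wqo_on A eq.
Proof.
move=> g _; pose h (i : 'I_#|F|.+1) := g i.
have /injectivePn[x [y xNy hxy]] : ~~ injectiveb h.
  apply/negP => /injectiveP/leq_card; by rewrite card_ord ltnn.
have [xy|yx|/val_inj xy] := ltngtP x y.
- by exists x, y.
- by exists y, x.
- by rewrite xy eqxx in xNy.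
Qed.

Lemma wqo_on_prod T1 T2 (A1 : pred T1) (A2 : pred T2)
    (R1 : T1 -> T1 -> Prop) (R2 : T2 -> T2 -> Prop) :
  wqo_on A1 R1 -> trans_rel R1 -> wqo_on A2 R2 ->
  wqo_on (fun p : T1 * T2 => A1 p.1 && A2 p.2)
    (fun p q => R1 p.1 q.1 /\ R2 p.2 q.2).
Proof.
move=> wqo1 tr1 wqo2 g gA.
have gA1 i : A1 (g i).1 by case/andP: (gA i).
have [phi [phi_lt phi_R]] := wqo_on_mono wqo1 tr1 gA1.
have [|i [j [ij Rij]]] := wqo2 (fun i => (g (phi i)).2).
  by move=> i; case/andP: (gA (phi i)).
by exists (phi i), (phi j); split; [apply: phi_lt | split; first apply: phi_R].
Qed.

Inductive higman_le T (R : T -> T -> Prop) : seq T -> seq T -> Prop :=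
| higman_nil s : higman_le R [::] s
| higman_skip y s t : higman_le R s t -> higman_le R s (y :: t)
| higman_cons x y s t :
    R x y -> higman_le R s t -> higman_le R (x :: s) (y :: t).

Section Higman.
Variables (T : Type) (A : pred T) (R : T -> T -> Prop).

Let bad (g : nat -> seq T) : Prop :=
  (forall i, all A (g i)) /\ forall i j, i < j -> ~ higman_le R (g i) (g j).

Let minimal_at n (g : nat -> seq T) : Prop :=
  forall h, bad h -> (forall i, i < n -> h i = g i) -> size (g n) <= size (h n).

(** Descent on the length of [g n], among bad sequences sharing the first [n] words. *)
Lemma minimize_at n g : bad g ->
  exists g', [/\ bad g', forall i, i < n -> g' i = g i & minimal_at n g'].
Proof.
have [s] := ubnP (size (g n)); elim: s g => // s IHs g sz bg.
have [[h [bh hg szh]]|min] := pselect (exists h,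
  [/\ bad h, forall i, i < n -> h i = g i & size (h n) < size (g n)]).
  have [g' [bg' g'h min']] := IHs h (leq_trans szh sz) bh.
  by exists g'; split=> // i ni; rewrite g'h ?hg.
exists g; split=> // h bh hg; rewrite leqNgt; apply/negP => szh.
by apply: min; exists h.
Qed.

(** Stage [n.+1] minimizes the word at index [n] and freezes the earlier ones. The diagonal agrees
    with each stage on an initial segment, and badness, which concerns at most two indices at a
    time, passes to it. *)
Lemma minimal_bad_sequence g : bad g ->
  exists m, bad m /\ forall n, minimal_at n m.
Proof.
move=> bg.
have /choice[st stP] (p : nat * (nat -> seq T)) : exists g', bad p.2 ->
    [/\ bad g', forall i, i < p.1 -> g' i = p.2 i & minimal_at p.1 g'].
  have [/(minimize_at p.1)[g' g'P]|nb] := pselect (bad p.2); first by exists g'.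
  by exists g.
pose G := fix G n := if n is n'.+1 then st (n', G n') else g.
have bG n : bad (G n) by elim: n => //= n IHn; case: (stP (n, G n) IHn).
have G_stable n k i : i < n -> G (n + k) i = G n i.
  move=> i_n; elim: k => [|k IHk]; first by rewrite addn0.
  rewrite addnS /= -IHk; case: (stP (n + k, G (n + k)) (bG _)) => _ -> //=.
  exact: leq_trans i_n (leq_addr _ _).
pose m n := G n.+1 n.
have mG i n : i < n -> m i = G n i.
  by move=> i_n; rewrite /m -(subnKC i_n) G_stable.
exists m; split.
  split=> [i|i j ij]; first exact: (bG _).1.
  by rewrite (mG i j.+1) ?(mG j j.+1) //; [apply: (bG _).2 | apply: ltnW].
move=> n h bh hm; have [_ GS min] := stP (n, G n) (bG n).
by apply: min => // i i_n; rewrite hm // (mG i n.+1) // ltnW.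
Qed.

(* Nash-Williams: in a minimal bad sequence, pass to a subsequence with
   increasing heads; the tails along it then form a smaller bad sequence. *)
Theorem higman : wqo_on A R -> trans_rel R -> wqo_on (all A) (higman_le R).
Proof.
move=> wqoR trR g gA; apply: contrapT => none.
have [|m [[mA mbad] min]] := @minimal_bad_sequence g.
  by split=> // i j ij le; apply: none; exists i, j.
have /choice[ht htE] n : exists p, m n = p.1 :: p.2.
  case E: (m n) => [|a l]; last by exists (a, l).
  by case: (mbad n n.+1 (ltnSn n)); rewrite E; constructor.
have hA n : A (ht n).1 by have := mA n; rewrite htE => /andP[].
have [phi [phi_lt phi_R]] := wqo_on_mono wqoR trR hA.
(* Keeping the words of [m] before index [phi 0] makes minimality at [phi 0] applicable; there [h]
   has a word one letter shorter. *)
pose h i := if i < phi 0 then m i else (ht (phi (i - phi 0))).2.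
have hlt i : i < phi 0 -> h i = m i by rewrite /h => ->.
suff bh : bad h.
  have := min _ _ bh hlt; rewrite /h ltnn subnn htE /=.
  by rewrite ltnn.
split=> [i|i j ij].
  rewrite /h; case: ifP => _; first exact: mA.
  by have := mA (phi (i - phi 0)); rewrite htE => /andP[].
rewrite /h; case: (ltnP i (phi 0)) => hi; case: (ltnP j (phi 0)) => hj.
- exact: mbad.
- move=> le; apply: (mbad i (phi (j - phi 0))).
    apply: leq_trans hi _; case: (j - phi 0) => // k.
    exact/ltnW/phi_lt.
  by rewrite (htE (phi (j - _))); constructor.
- by rewrite ltnNge (leq_trans hi (ltnW ij)) in hj.
- move=> le; have lt : i - phi 0 < j - phi 0 by rewrite ltn_sub2r // (leq_ltn_trans hi).
  apply: (mbad _ _ (phi_lt _ _ lt)); rewrite !htE.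
  by apply: higman_cons => //; apply: phi_R.
Qed.

End Higman.
End WellQuasiOrders.

(** * The embedding order on words *)

Section Words.
Variables (M : finType) (mul : M -> M -> M) (one : M).
Hypotheses (mulA : associative mul) (mul1m : left_id one mul)
  (mulm1 : right_id one mul).

(** * Two-sided ideals and stability *)

Lemma JidealP m z : reflect (exists x y, z = mul (mul x m) y) (z \in Jideal mul m).
Proof.
apply: (iffP imset2P) => [[x y _ _ ->]|[x [y ->]]]; first by exists x, y.
by exists x y; rewrite ?inE.
Qed.

Lemma Jideal_refl m : m \in Jideal mul m.
Proof. by apply/JidealP; exists one, one; rewrite mul1m mulm1. Qed.

Lemma Jideal_mul x m y z :
  m \in Jideal mul z -> mul (mul x m) y \in Jideal mul z.
Proof.
case/JidealP=> u [v ->]; apply/JidealP; exists (mul x u), (mul v y).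
by rewrite !mulA.
Qed.

Lemma Jideal_sub m z : m \in Jideal mul z -> Jideal mul m \subset Jideal mul z.
Proof.
by move=> mz; apply/subsetP => _ /JidealP[x [y ->]]; apply: Jideal_mul.
Qed.

Lemma Jideal_subl a b : Jideal mul (mul a b) \subset Jideal mul a.
Proof.
by apply/Jideal_sub/JidealP; exists one, b; rewrite mul1m.
Qed.

Lemma Jideal_subr a b : Jideal mul (mul a b) \subset Jideal mul b.
Proof.
by apply/Jideal_sub/JidealP; exists a, one; rewrite mulm1.
Qed.

(* Stability of finite monoids: [c = x c q y] makes right multiplication by
   [y] followed by left multiplication by [x] a surjection from [c q M] onto
   [c M], while [c q M] is contained in [c M]. *)
Lemma stability c q : Jideal mul (mul c q) = Jideal mul c ->
  exists t, c = mul (mul c q) t.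
Proof.
move=> eqJ; pose ri m := [set mul m y | y : M].
have /JidealP[x [y cE]] : c \in Jideal mul (mul c q) by rewrite eqJ Jideal_refl.
have sub : ri (mul c q) \subset ri c.
  apply/subsetP => _ /imsetP[t _ ->]; apply/imsetP.
  by exists (mul q t); rewrite ?mulA.
have le : #|ri c| <= #|ri (mul c q)|.
  apply: leq_trans (leq_imset_card (mul x) _); apply: subset_leq_card.
  apply/subsetP => _ /imsetP[t _ ->]; apply/imsetP.
  exists (mul (mul c q) (mul y t)); first exact: imset_f.
  by rewrite {1}cE !mulA.
have /eqP eq_ri : ri (mul c q) == ri c by rewrite eqEcard sub.
have /imsetP[t _ ct] : c \in ri (mul c q).
  by rewrite eq_ri; apply/imsetP; exists one; rewrite ?mulm1.
by exists t.
Qed.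

Definition rank m := #|Jideal mul m|.

Variable X : finType.
Definition letter : Type := (M + X)%type.
Implicit Types (u v w : seq letter) (k : nat).

Definition is_elt (a : letter) : bool := if a is inl _ then true else false.
Definition letter_val (a : letter) : M := if a is inl m then m else one.
Definition eval w := foldr (fun a m => mul (letter_val a) m) one w.

Lemma eval_cat u w : eval (u ++ w) = mul (eval u) (eval w).
Proof. by elim: u => [|a u IHu] /=; rewrite ?mul1m // IHu mulA. Qed.

(* [emb u w]: erasing some of the vertices of [w], and multiplying the elements
   that become adjacent, gives [u]. *)
Inductive emb : seq letter -> seq letter -> Prop :=
| emb_val u w : all is_elt u -> eval u = eval w -> emb u w
| emb_vtx x y c u w : all is_elt x -> eval x = eval y -> emb u w ->
    emb (x ++ inr c :: u) (y ++ inr c :: w).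

Lemma emb_eval u w : emb u w -> eval u = eval w.
Proof.
elim=> // x y c {}u {}w _ exy _ IHu.
by rewrite !eval_cat /= exy IHu.
Qed.

(** At the seam, the elements after the last vertex of [u] join those before the first vertex of
    [u'], and the value of the joined stretch is preserved. *)
Lemma emb_cat u w u' w' : emb u w -> emb u' w' -> emb (u ++ u') (w ++ w').
Proof.
move=> uw uw'; elim: uw => [{}u {}w ue euw|x y c {}u {}w xe exy _ IHu].
  elim: uw' => [{}u' {}w' ue' euw'|x y c {}u' {}w' xe exy uw' _].
    by apply: emb_val; rewrite ?all_cat ?ue // !eval_cat euw euw'.
  rewrite !catA; apply: emb_vtx => //; first by rewrite all_cat ue.
  by rewrite !eval_cat euw exy.
by rewrite -!catA; apply: emb_vtx.
Qed.

Lemma first_vertex_split x y c d u v :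
  all is_elt x -> x ++ inr d :: u = y ++ inr c :: v ->
  [/\ y = x, c = d & v = u] \/
  exists y', y = x ++ inr d :: y' /\ u = y' ++ inr c :: v.
Proof.
elim: x y => [|a x IHx] [|b y] //=.
- by move=> _ [-> ->]; left.
- by move=> _ [<- ->]; right; exists y.
- by move=> /andP[+ _] [aE _]; rewrite aE.
- move=> /andP[_ xe] [<-] /(IHx _ xe)[[-> -> ->]|[y' [-> ->]]].
    by left.
  by right; exists y'.
Qed.

(** Cutting the source at a vertex cuts the target at its image; this is what lets embeddings be
    composed. *)
Lemma emb_split y c v w : emb (y ++ inr c :: v) w ->
  exists y' w', [/\ w = y' ++ inr c :: w', emb y y' & emb v w'].
Proof.
move E: (y ++ _) => t tw; elim: tw y E => [u {}w ue _ y E|].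
  by move: ue; rewrite -E all_cat /= andbF.
move=> x z d u {}w xe exz uw IHu y /esym/(first_vertex_split xe).
case=> [[-> -> ->]|[y1 [-> /esym/IHu[y' [w' [-> yy' vw']]]]]].
  by exists z, w; split=> //; apply: emb_val.
exists (z ++ inr d :: y'), w'; split; rewrite -?catA //.
exact: emb_vtx.
Qed.

Lemma emb_trans : trans_rel emb.
Proof.
move=> u v w uv; elim: uv w => [{}u {}v ue euv w /emb_eval evw|].
  by apply: emb_val; rewrite // euv.
move=> x y c {}u {}v xe exy _ IHu w /emb_split[y' [w' [-> /emb_eval yy' vw']]].
by apply: emb_vtx; [|rewrite exy|apply: IHu].
Qed.

(** * Ranks and the decomposition into blocks *)

Definition high k (a : letter) : bool :=
  if a is inl m then k <= rank m else true.

(** Total ordering enters the well-quasi-ordering of words only through this bound. *)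
Lemma rank_mul k a b : totally_ordered mul ->
  k <= rank a -> k <= rank b -> k <= rank (mul a b).
Proof. by rewrite /rank => tot ha hb; case: (tot a b) => ->. Qed.

Lemma rank_one_max m : rank m <= rank one.
Proof.
apply/subset_leq_card/Jideal_sub/JidealP.
by exists m, one; rewrite !mulm1.
Qed.

Lemma rank_eval k w : totally_ordered mul -> k <= rank one ->
  all (high k) w -> k <= rank (eval w).
Proof.
move=> tot k1; elim: w => //= a w IHw /andP[ka /IHw kw].
by apply: rank_mul => //; case: a ka.
Qed.

(* A word [H0 c1 H1 .. ct Ht], where the [ci] have rank exactly [k], is cut
   into [H0] and the blocks [(ci, Hi, si)]; [si] is the value of everything to
   the right of [Hi]. *)
Definition block : Type := (M * M * seq letter)%type.
Implicit Types (b : block) (s t : seq block).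

Definition blocks_word s : seq letter :=
  flatten [seq inl b.1.1 :: b.2 | b <- s].

Fixpoint blocks_annotated s : Prop :=
  if s is b :: s' then eval (blocks_word s') = b.1.2 /\ blocks_annotated s'
  else True.

Definition block_le b1 b2 : Prop := b1.1 = b2.1 /\ emb b1.2 b2.2.

Definition block_high k b : bool := (rank b.1.1 == k) && all (high k.+1) b.2.

Lemma blocks_wordP k w : all (high k) w ->
  exists H s, [/\ w = H ++ blocks_word s, all (high k.+1) H,
    all (block_high k) s & blocks_annotated s].
Proof.
elim: w => [_|a w IHw /= /andP[ha /IHw[H [s [-> hH hs ann]]]]].
  by exists [::], [::].
case haP: (high k.+1 a).
  by exists (a :: H), s; split=> //=; rewrite haP.
case: a ha haP => //= m; rewrite leq_eqVlt => /orP[/eqP mk _|->] //.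
(* A letter of rank exactly [k] opens a block, whose body is the high prefix [H] found so far. *)
exists [::], ((m, eval (blocks_word s), H) :: s); split=> //=.
by rewrite /block_high /= -mk eqxx /= hH.
Qed.

Lemma rank_blocks k s : totally_ordered mul -> k <= rank one ->
  all (block_high k) s -> k <= rank (eval (blocks_word s)).
Proof.
move=> tot k1 hs; apply: rank_eval => //.
elim: s hs => //= b s IHs /andP[/andP[/eqP bk hH] /IHs hs].
rewrite /= bk leqnn all_cat hs andbT; apply: sub_all hH => -[m|x] //=; exact: ltnW.
Qed.

(** The word [y] accumulates the blocks of [t] skipped since the last matched one. The equality of
    values is the invariant that lets the next matched letter absorb [y]. *)
Lemma emb_blocks k s t y : totally_ordered mul ->
  higman_le block_le s t -> all (block_high k) s ->
  blocks_annotated s -> blocks_annotated t ->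
  eval (blocks_word s) = eval (y ++ blocks_word t) ->
  emb (blocks_word s) (y ++ blocks_word t).
Proof.
move=> tot st; elim: st y => [{}t y _ _ _ e|b {}s {}t _ IHs y hs ann [_ annt] e|].
- exact: emb_val.
- rewrite /blocks_word /= -/(blocks_word t) -cat_cons catA.
  apply: IHs => //; by rewrite -catA.
move=> [[c q] H] [[c' q'] H'] {}s {}t [/=[<- <-] HH'] _ IHs y.
move=> /= /andP[/andP[/= /eqP ck hH] hs] [sq ann] [tq annt].
rewrite /blocks_word /= -/(blocks_word s) -/(blocks_word t) eval_cat /=.
rewrite !eval_cat sq tq -(emb_eval HH') => e.
(* What follows [c] has value [mul (eval H) q]. Multiplying [c] by it keeps the rank at least [k],
   the rank of [c], so the ideal is unchanged and stability cancels this factor in [e]. *)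
have ky : mul (eval y) c = c.
  have [|r cE] := @stability c (mul (eval H) q).
    apply/eqP; rewrite eqEcard Jideal_subl /= -/(rank c) -/(rank _) ck.
    have k1 : k <= rank one by rewrite -ck rank_one_max.
    apply: rank_mul => //; first by rewrite ck.
    apply: rank_mul => //; last by rewrite -sq rank_blocks.
    by apply: rank_eval => //; apply: sub_all hH => -[m|x] //=; apply: ltnW.
  by rewrite {1}cE mulA -e -cE.
rewrite -cat_rcons -cats1; apply: (@emb_cat [:: inl c]).
  by apply: emb_val => //; rewrite eval_cat /= !mulm1 ky.
(* After a match nothing is pending, and the common annotation [q] provides the equality of values
   again. *)
apply: emb_cat => //; apply: (IHs [::]) => //; by rewrite /= sq tq.
Qed.

Lemma block_le_trans : trans_rel block_le.
Proof.
move=> b1 b2 b3 [e12 h12] [e23 h23]; split; first by rewrite e12.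
exact: emb_trans h12 h23.
Qed.

Lemma emb_subword u w : higman_le eq u w ->
  all (fun a => ~~ is_elt a) w -> emb u w.
Proof.
elim=> {u w} [w we|a u w _ IHu /= /andP[ae we]|a _ u w <- _ IHu /= /andP[ae we]].
- by apply: emb_val => //; elim: w we => // -[m|c] w IHw //= /IHw <-; rewrite mul1m.
- apply: (@emb_cat [::] [:: a]); last exact: IHu.
  by apply: emb_val => //; case: a ae => //= c; rewrite mul1m.
- apply: (@emb_cat [:: a] [:: a]); last exact: IHu.
  case: a ae => // c _.
  by apply: (@emb_vtx [::] [::]) => //; apply: emb_val.
Qed.

Lemma wqo_on_no_elt : wqo_on (all (fun a => ~~ is_elt a)) emb.
Proof.
move=> g gA.
have wqo_eq : wqo_on (fun a : letter => ~~ is_elt a) eq.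
  exact: (@wqo_on_eq (M + X)%type).
have [|i [j [ij le]]] := higman wqo_eq _ gA; first by move=> ? ? ? -> ->.
by exists i, j; split=> //; apply: emb_subword.
Qed.

(** Descending induction on [k]. Ranks are at most [#|M|], so beyond that only vertices remain,
    which count as high for every [k]. Otherwise the block bodies fall under the case [k.+1]. *)
Lemma wqo_on_high : totally_ordered mul -> forall k, wqo_on (all (high k)) emb.
Proof.
move=> tot k; have [n] := ubnP (#|M|.+1 - k); elim: n k => // n IHn k nk.
have [kM|Mk] := leqP k #|M|; last first.
  move=> g gA; apply: wqo_on_no_elt => i; apply: sub_all (gA i) => -[m|x] //= km.
  have := leq_trans km (max_card _); by rewrite leqNgt Mk.
have IH : wqo_on (all (high k.+1)) emb by apply: IHn; lia.
have wqo_eqM : wqo_on predT (@eq M) by apply: wqo_on_eq.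
have eqM_trans : trans_rel (@eq M) by move=> ? ? ? -> ->.
have wqo_block : wqo_on (block_high k) block_le.
  move=> g gA; have [|||i [j [ij le]]] :=
    @wqo_on_prod _ _ predT _ (@eq (M * M)%type) _ _ _ IH g.
  - exact: wqo_on_eq.
  - by move=> ? ? ? -> ->.
  - by move=> i; case/andP: (gA i).
  by exists i, j.
have wqo_pair := wqo_on_prod wqo_eqM eqM_trans (higman wqo_block block_le_trans).
have wqo_all := wqo_on_prod IH emb_trans wqo_pair.
move=> g gA.
(* The total value of the blocks is stored too, because [emb_blocks] starts from its equality on
   both sides. *)
have /choice[d dP] i : exists p : seq letter * (M * seq block),
    [/\ g i = p.1 ++ blocks_word p.2.2, all (high k.+1) p.1,
        all (block_high k) p.2.2, blocks_annotated p.2.2 &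
        p.2.1 = eval (blocks_word p.2.2)].
  have [H [s [? ? ? ?]]] := blocks_wordP (gA i).
  by exists (H, (eval (blocks_word s), s)).
have [|i [j [ij [leH [/= les leb]]]]] := wqo_all d.
  by move=> i; have [_ -> -> _ _] := dP i.
exists i, j; split=> //.
have [-> _ hi ai ei] := dP i; have [-> _ _ aj ej] := dP j.
apply: emb_cat => //; apply: (@emb_blocks k _ _ [::]) => //=.
by rewrite -ei -ej.
Qed.

Lemma wqo_emb : totally_ordered mul -> wqo_on predT emb.
Proof.
move=> tot g _; apply: (wqo_on_high tot (k := 0)) => i.
by apply/allP => -[].
Qed.

(** * Vertices of a word and the values that they delimit *)

Definition vertices w := count (fun a => ~~ is_elt a) w.

(** A vertex is addressed by its rank among the vertices, counted from 0 and skipping elements. *)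
Fixpoint color w i : option X :=
  match w with
  | [::] => None
  | inl _ :: w' => color w' i
  | inr c :: w' => if i is i'.+1 then color w' i' else Some c
  end.

Fixpoint before w i : M :=
  match w with
  | [::] => one
  | inl m :: w' => mul m (before w' i)
  | inr _ :: w' => if i is i'.+1 then before w' i' else one
  end.

Fixpoint after w i : M :=
  match w with
  | [::] => one
  | inl _ :: w' => after w' i
  | inr _ :: w' => if i is i'.+1 then after w' i' else eval w'
  end.

(* Junk value [one] unless [i < j]. *)
Fixpoint between w i j : M :=
  match w with
  | [::] => one
  | inl _ :: w' => between w' i j
  | inr _ :: w' =>
      match i, j with
      | 0, j'.+1 => before w' j'
      | i'.+1, j'.+1 => between w' i' j'
      | _, _ => one
      end
  end.

Lemma color_cat y w i : color (y ++ w) (vertices y + i) = color w i.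
Proof. by elim: y => //= -[m|c] y IHy. Qed.

Lemma before_cat y w i :
  before (y ++ w) (vertices y + i) = mul (eval y) (before w i).
Proof.
by elim: y => [|[m|c] y IHy] /=; rewrite ?add0n ?mul1m ?add1n //= IHy ?mulA.
Qed.

Lemma after_cat y w i : after (y ++ w) (vertices y + i) = after w i.
Proof. by elim: y => //= -[m|c] y IHy. Qed.

Lemma between_cat y w i j :
  between (y ++ w) (vertices y + i) (vertices y + j) = between w i j.
Proof. by elim: y => //= -[m|c] y IHy. Qed.

Lemma vertices_elt x : all is_elt x -> vertices x = 0.
Proof. by elim: x => //= -[m|c] x IHx. Qed.

Lemma emb_vertex_map u w : emb u w -> exists f : nat -> nat,
  (forall i, i < vertices u ->
     [/\ f i < vertices w, color w (f i) = color u i,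
         before w (f i) = before u i & after w (f i) = after u i]) /\
  (forall i j, i < j -> j < vertices u ->
     f i < f j /\ between w (f i) (f j) = between u i j).
Proof.
elim=> [{}u {}w ue _|x y c {}u {}w xe exy uw [f [f1 f2]]].
  by exists id; split=> [i|i j _]; rewrite vertices_elt.
(* The first vertex goes to the one just after [y]; the others follow [f], shifted past it. *)
exists (fun i => vertices y + (if i is i'.+1 then (f i').+1 else 0)).
have vx := vertices_elt xe.
have vE z v : vertices (z ++ inr c :: v) = vertices z + (vertices v).+1.
  by rewrite /vertices count_cat.
have colE v i : color (x ++ v) i = color v i by have := color_cat x v i; rewrite vx.
have befE v i : before (x ++ v) i = mul (eval y) (before v i).
  by have := before_cat x v i; rewrite vx exy.
have aftE v i : after (x ++ v) i = after v i by have := after_cat x v i; rewrite vx.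
have betE v i j : between (x ++ v) i j = between v i j.
  by have := between_cat x v i j; rewrite vx.
split=> [i|i j]; rewrite !vE vx add0n ltnS.
  rewrite ltn_add2l color_cat before_cat after_cat colE befE aftE.
  case: i => [|i] iu /=; first by split; rewrite // (emb_eval uw).
  by have [? -> -> ->] := f1 i iu.
move=> ij ju; rewrite ltn_add2l between_cat betE.
case: i j ij ju => [|i] [|j] //= ij ju; last exact: f2.
by have [_ _ -> _] := f1 j ju.
Qed.

End Words.

(** * Graphs as words *)

Section Representation.
Variables (M : finType) (mul : M -> M -> M) (one : M).
Hypotheses (mulA : associative mul) (mul1m : left_id one mul)
  (mulm1 : right_id one mul).
Implicit Types (v w : seq (M * M)) (P : {set M * M * M}) (G : mlgraph M).

Definition prod_word w := foldr (fun a m => mul (mul a.1 a.2) m) one w.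

Definition label_at w i := nth (one, one) w i.

(** [left_val] and [right_val] are the two components of the label that vertex [i] receives in the
    product along [w]; for [i < j], [mid_val] is the middle entry tested against the selector. *)
Definition left_val w i := mul (prod_word (take i w)) (label_at w i).1.

Definition right_val w i := mul (label_at w i).2 (prod_word (drop i.+1 w)).

Definition mid_val w i j :=
  mul (mul (label_at w i).2 (prod_word (drop i.+1 (take j w)))) (label_at w j).1.

Lemma prod_word_cat v w :
  prod_word (v ++ w) = mul (prod_word v) (prod_word w).
Proof. by elim: v => [|a v IHv] /=; rewrite ?mul1m // IHv mulA. Qed.

Lemma drop_catl T (s t : seq T) n : n <= size s -> drop n (s ++ t) = drop n s ++ t.
Proof.
rewrite drop_cat leq_eqVlt => /orP[/eqP ->|-> //].
by rewrite ltnn subnn drop0 drop_size.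
Qed.

Lemma left_val_catl v w i : i < size v -> left_val (v ++ w) i = left_val v i.
Proof.
by move=> iv; rewrite /left_val /label_at nth_cat iv takel_cat // ltnW.
Qed.

Lemma right_val_catl v w i : i < size v ->
  right_val (v ++ w) i = mul (right_val v i) (prod_word w).
Proof.
by move=> iv; rewrite /right_val /label_at nth_cat iv drop_catl // prod_word_cat mulA.
Qed.

Lemma mid_val_catl v w i j : i < j -> j < size v ->
  mid_val (v ++ w) i j = mid_val v i j.
Proof.
move=> ij jv; rewrite /mid_val /label_at !nth_cat (ltn_trans ij jv) jv.
by rewrite takel_cat // ltnW.
Qed.

Lemma nth_cat_add T (x0 : T) (s t : seq T) i : nth x0 (s ++ t) (size s + i) = nth x0 t i.
Proof. by rewrite nth_cat ltnNge leq_addr addKn. Qed.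

Lemma take_cat_add T (s t : seq T) i : take (size s + i) (s ++ t) = s ++ take i t.
Proof. by rewrite take_cat ltnNge leq_addr addKn. Qed.

Lemma drop_cat_add T (s t : seq T) i : drop (size s + i) (s ++ t) = drop i t.
Proof. by rewrite drop_cat ltnNge leq_addr addKn. Qed.

Lemma left_val_catr v w i :
  left_val (v ++ w) (size v + i) = mul (prod_word v) (left_val w i).
Proof.
by rewrite /left_val /label_at nth_cat_add take_cat_add prod_word_cat mulA.
Qed.

Lemma right_val_catr v w i : right_val (v ++ w) (size v + i) = right_val w i.
Proof. by rewrite /right_val /label_at nth_cat_add -addnS drop_cat_add. Qed.

Lemma mid_val_catr v w i j :
  mid_val (v ++ w) (size v + i) (size v + j) = mid_val w i j.
Proof.
by rewrite /mid_val /label_at !nth_cat_add take_cat_add -addnS drop_cat_add.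
Qed.

Lemma mid_val_cat v w i j : i < size v ->
  mid_val (v ++ w) i (size v + j) = mul (right_val v i) (left_val w j).
Proof.
move=> iv; rewrite /mid_val /label_at nth_cat_add take_cat_add nth_cat iv.
by rewrite drop_catl // prod_word_cat !mulA.
Qed.

(* Up to associativity, a graph built by products of one-vertex graphs is
   determined by the word of labels of these graphs. *)
Definition represents P G w : Prop :=
  [/\ mlg_n G = size w, mlg_eval G = prod_word w,
      forall x : 'I_(mlg_n G), mlg_lab x = (left_val w x, right_val w x) &
      forall x y : 'I_(mlg_n G), x < y -> forall s t,
        mlg_E x y s t =
          ((mul s (left_val w x), mid_val w x y, mul (right_val w y) t) \in P)
        /\ mlg_E y x s t = mlg_E x y s t].

(** Inside a factor, the arguments [s] and [t] of the edge function absorb the evaluation of the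
    other factor. Across the factors, the edge rule of the product reads off [mid_val_cat]. *)
Lemma represents_mprod P G1 G2 w1 w2 :
  represents P G1 w1 -> represents P G2 w2 ->
  represents P (mprod mul P G1 G2) (w1 ++ w2).
Proof.
move=> [n1 e1 l1 E1] [n2 e2 l2 E2].
have lt1 (i : 'I_(mlg_n G1)) : i < size w1 by rewrite -n1.
have addE k : mlg_n G1 + k = size w1 + k by rewrite n1.
split=> /=; rewrite ?size_cat ?prod_word_cat ?n1 ?n2 ?e1 ?e2 //.
- move=> x; case: splitP => i ->.
    by rewrite l1 /= left_val_catl // right_val_catl.
  by rewrite l2 /= addE left_val_catr right_val_catr.
- move=> x y; case: splitP => i ->; case: splitP => j -> ij s t.
  + have [-> ->] := E1 i j ij s (mul (prod_word w2) t).
    rewrite !left_val_catl // mid_val_catl // right_val_catl //.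
    by rewrite mulA.
  + by rewrite l1 l2 /= addE left_val_catl // mid_val_cat // right_val_catr.
  + by have := lt1 j; lia.
  + have ij' : i < j by lia.
    have [-> ->] := E2 i j ij' (mul s (prod_word w1)) t.
    by rewrite !addE left_val_catr mid_val_catr right_val_catr mulA.
Qed.

Lemma represents_foldl P G (Gs : seq (mlgraph M)) :
  (exists w, represents P G w) ->
  (forall i, i < size Gs -> exists w, represents P (nth G Gs i) w) ->
  exists w, represents P (foldl (mprod mul P) G Gs) w.
Proof.
elim: Gs G => //= G' Gs IHGs G [w Gw] Gsw; apply: IHGs => [|i iGs].
  by have [w' G'w'] := Gsw 0 isT; exists (w ++ w'); apply: represents_mprod.
by rewrite (set_nth_default G) //; apply: (Gsw i.+1).
Qed.

(** An idempotent product is an iterated binary product, so both product rules amount to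
    concatenation of words. *)
Lemma Reg_represents P d G : Reg mul P d G -> exists w, represents P G w.
Proof.
elim=> [{}G n1 wf|k G1 G2 _ [w1 r1] _ [w2 r2]|k e {}G Gs _ _ Gw _ _ Gsw _].
- case: G n1 wf => m n E l /= n1; subst n => wf; exists [:: l ord0].
  have x0 (x : 'I_1) : x = ord0 by apply: ord1.
  split=> //= [|x|x y]; first by have /= <- := wf ord0; rewrite mulm1.
    rewrite (x0 x) /left_val /right_val /label_at /= mul1m mulm1.
    by case: (l ord0).
  by rewrite (x0 x) (x0 y) ltnn.
- by exists (w1 ++ w2); apply: represents_mprod.
- exact: represents_foldl.
Qed.

Variable X : finType.

(** Writing a vertex labelled [(l, r)] between the elements [l] and [r] makes [before], [between]
    and [after] agree with [left_val], [mid_val] and [right_val]. *)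
Definition vertex_word w (c : seq X) : seq (letter M X) :=
  flatten [seq [:: inl a.1.1; inr a.2; inl a.1.2] | a <- zip w c].

Lemma vertex_wordE w c : size w = size c ->
  [/\ vertices (vertex_word w c) = size w,
      eval mul one (vertex_word w c) = prod_word w,
      forall i x0, i < size w -> color (vertex_word w c) i = Some (nth x0 c i),
      forall i, i < size w -> before mul one (vertex_word w c) i = left_val w i &
      (forall i, i < size w -> after mul one (vertex_word w c) i = right_val w i) /\
      (forall i j, i < j -> j < size w ->
         between mul one (vertex_word w c) i j = mid_val w i j)].
Proof.
elim: w c => [|a w IHw] [|x c] //= [/IHw[nE eE cE bE [aE tE]]].
rewrite -/(vertex_word w c) in nE eE cE bE aE tE *.
have befE i : i < size w -> mul a.1 (mul a.2 (left_val w i)) = left_val (a :: w) i.+1.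
  by rewrite /left_val /label_at /= !mulA.
split; rewrite ?nE //.
- by rewrite eE mul1m mulA.
- by case=> //= i x0; apply: cE.
- case=> [_|i iw]; first by rewrite /left_val /= mul1m mulm1.
  by rewrite bE // befE.
- split; first by case=> [_|i iw]; [rewrite /= eE /right_val /= drop0 | apply: aE].
  case=> [|i] [|j] //= ij jw; last exact: tE.
  by rewrite bE // /mid_val /= drop0 -mulA.
Qed.

(** Loops and reversed pairs are included because [lembeds] compares adjacency on all ordered
    pairs. *)
Definition read_off P (g : sgraph) (lab : 'I_(sg_n g) -> X) u : Prop :=
  [/\ vertices u = sg_n g,
      forall x : 'I_(sg_n g), color u x = Some (lab x),
      forall x : 'I_(sg_n g), sg_adj x x = false &
      forall x y : 'I_(sg_n g), x < y ->
        sg_adj x y = ((before mul one u x, between mul one u x y,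
                       after mul one u y) \in P)
        /\ sg_adj y x = sg_adj x y].

Lemma dc_read_off P d G (lab : 'I_(sg_n (dc one G)) -> X) : Reg mul P d G ->
  exists u, read_off P lab u.
Proof.
case/Reg_represents=> w [nE eE lE adjE].
have sz : size w = size [seq lab i | i <- enum 'I_(mlg_n G)].
  by rewrite size_map size_enum_ord.
have [vE _ cE bE [aE tE]] := vertex_wordE sz.
have lt (i : 'I_(mlg_n G)) : i < size w by rewrite -nE.
exists (vertex_word w [seq lab i | i <- enum 'I_(mlg_n G)]); split.
- by rewrite vE.
- move=> x; rewrite (cE _ (lab x)) //; congr Some.
  by rewrite (nth_map x) ?size_enum_ord // nth_ord_enum.
- by move=> x; rewrite /= eqxx.
- move=> x y xy /=; have [E1 E2] := adjE x y xy one one.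
  have /negPf xNy : x != y by apply: contraTneq xy => ->; rewrite ltnn.
  rewrite (eq_sym y) xNy /= E2 E1 mul1m mulm1.
  by rewrite bE // aE // tE.
Qed.

(** The vertex map is increasing, hence injective, and it preserves the triple that decides each
    edge. *)
Lemma emb_lembeds P (g h : sgraph) (lg : 'I_(sg_n g) -> X)
    (lh : 'I_(sg_n h) -> X) u u' :
  read_off P lg u -> read_off P lh u' -> emb mul one u u' -> lembeds lg lh.
Proof.
move=> [nu cu iu au] [nw cw iw aw] /(emb_vertex_map mulA mul1m)[f [f1 f2]].
have lt_u (x : 'I_(sg_n g)) : x < vertices u by rewrite nu.
have f_lt (x : 'I_(sg_n g)) : f x < sg_n h by rewrite -nw; case: (f1 x (lt_u x)).
pose F x := Ordinal (f_lt x).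
have F_lt (x y : 'I_(sg_n g)) : x < y -> F x < F y.
  by move=> xy; have [] := f2 x y xy (lt_u y).
have F_adj (x y : 'I_(sg_n g)) : x < y ->
    sg_adj (F x) (F y) = sg_adj x y /\ sg_adj (F y) (F x) = sg_adj y x.
  move=> xy; have [-> ->] := aw _ _ (F_lt _ _ xy); have [-> ->] := au _ _ xy.
  have [_ _ -> _] := f1 x (lt_u x); have [_ _ _ ->] := f1 y (lt_u y).
  by have [_ ->] := f2 x y xy (lt_u y).
exists F; split.
- move=> x y Fxy; have [xy|yx|/val_inj //] := ltngtP x y.
    by have := F_lt _ _ xy; rewrite Fxy ltnn.
  by have := F_lt _ _ yx; rewrite Fxy ltnn.
- move=> x y; have [/F_adj[]//|/F_adj[]//|/val_inj <-] := ltngtP x y.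
  by rewrite iw iu.
- move=> x; have [_ cE _ _] := f1 x (lt_u x).
  by apply: Some_inj; rewrite -cu -cw -cE.
Qed.

End Representation.

Theorem totally_ordered_inf_wqo (M : finType) (mul : M -> M -> M) (one : M)
    (mulA : associative mul) (mul1m : left_id one mul) (mulm1 : right_id one mul)
    (P : {set M * M * M}) (d : nat) :
  totally_ordered mul -> inf_wqo (dc_Reg_class mul one P d).
Proof.
move=> tot X g lab gC.
have /choice[u uP] i : exists u, read_off mul one P (lab i) u.
  have [G [GR gE]] := gC i; move: (lab i); rewrite gE => labG.
  exact: dc_read_off GR.
have [//|i [j [ij e]]] := wqo_emb mulA mul1m mulm1 tot (g := u).
by exists i, j; split=> //; apply: emb_lembeds e.
Qed.

(** * Long paths over a monoid that is not totally ordered *)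

Section LongPaths.
Variables (M : finType) (mul : M -> M -> M) (one : M).
Hypotheses (mulA : associative mul) (mul1m : left_id one mul)
  (mulm1 : right_id one mul).
Implicit Types (v w : seq (M * M)) (G : mlgraph M).

(** Binary products combine graphs of equal depth, so the word is halved [k] times. *)
Lemma Reg_of_word P k w : size w = 2 ^ k ->
  exists G, Reg mul P k G /\ represents mul one P G w.
Proof.
elim: k w => [|k IHk] w.
  case: w => [|a []] // _.
  exists (@MLGraph M (mul a.1 a.2) 1 (fun _ _ _ _ => false) (fun=> a)).
  split; first exact: Reg_base.
  split=> //= [x|x y].
  - rewrite (ord1 x) /left_val /right_val /label_at /= mul1m mulm1.
    by case: (a).
  - by rewrite (ord1 x) (ord1 y) ltnn.
rewrite expnS => sz.
have [|G1 [R1 r1]] := IHk (take (2 ^ k) w); first by rewrite size_takel; lia.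
have [|G2 [R2 r2]] := IHk (drop (2 ^ k) w); first by rewrite size_drop; lia.
exists (mprod mul P G1 G2); split; first exact: Reg_bin.
by rewrite -(cat_take_drop (2 ^ k) w); apply: represents_mprod.
Qed.

Lemma represents_foldl_nseq P G G0 w w0 n :
  represents mul one P G w -> represents mul one P G0 w0 ->
  represents mul one P (foldl (mprod mul P) G (nseq n G0))
    (w ++ flatten (nseq n w0)).
Proof.
move=> + r0; elim: n G w => [|n IHn] G w r; first by rewrite cats0.
by rewrite /= catA; apply: IHn; apply: represents_mprod.
Qed.

Lemma expm_idem s : exists n, 0 < n /\
  mul (iter n (mul s) one) (iter n (mul s) one) = iter n (mul s) one.
Proof.
pose e n := iter n (mul s) one.
have eD m n : e (m + n) = mul (e m) (e n).
  by elim: m => [|m IHm]; rewrite ?mul1m // addSn /= IHm mulA.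
have /injectivePn[x [y xNy exy]] : ~~ injectiveb (fun i : 'I_#|M|.+1 => e i).
  apply/negP => /injectiveP/leq_card; by rewrite card_ord ltnn.
wlog xy : x y xNy exy / x < y.
  move=> wl; have [xy|yx|/val_inj xy] := ltngtP x y; first exact: (wl x y).
    by apply: (wl y x) => //; rewrite eq_sym.
  by rewrite xy eqxx in xNy.
have per m k : x <= m -> e (m + k * (y - x)) = e m.
  move=> xm; elim: k => [|k IHk]; first by rewrite addn0.
  have -> : m + k.+1 * (y - x) = (m + k * (y - x) - x) + y by nia.
  rewrite eD -exy -eD -[RHS]IHk; congr e; nia.
(* The powers have period [y - x] from exponent [x] on. This exponent is a positive multiple of the
   period and at least [x], so doubling it leaves the power unchanged. *)
exists (x.+1 * (y - x)); split; first by nia.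
by rewrite -eD per //; nia.
Qed.

(* The labels [(one, z)] put the elements [z] between consecutive vertices. *)
Variables (I : {set M}) (b : seq (M * M)).
Hypothesis I_mul : forall x m y, m \in I -> mul (mul x m) y \in I.
Hypothesis b_notin : all (fun a => (a.1 == one) && (a.2 \notin I)) b.
Hypothesis b_in : prod_word mul one b \in I.

Definition mid_selector : {set M * M * M} := [set t | t.1.2 \notin I].

(** The block [q] that follows the block of [x] lies entirely between the two vertices, and its
    value belongs to the ideal [I]. *)
Lemma mid_val_blocks n x y : y < n * size b ->
  (x %/ size b).+1 < y %/ size b ->
  mid_val mul one (flatten (nseq n b)) x y \in I.
Proof.
move=> y_lt xy; set K := size b in y_lt xy *.
have K0 : 0 < K by rewrite lt0n; apply: contraTneq y_lt => ->; rewrite muln0.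
have [q qE] : exists q, q = (x %/ K).+1 by exists (x %/ K).+1.
rewrite -qE in xy.
have qn : q < n by rewrite (ltn_trans xy) // ltn_divLR.
have -> : n = q + (n - q.+1).+1 by lia.
rewrite /mid_val nseqD flatten_cat /= -/K.
set s := flatten (nseq q b); set t := flatten (nseq (n - q.+1) b).
have sz_s : size s = q * K by rewrite /s size_flatten /shape map_nseq sumn_nseq mulnC.
have xs : x < q * K by rewrite -ltn_divLR // qE.
have sy : q.+1 * K <= y by rewrite -leq_divRL.
have -> : take y (s ++ b ++ t) = s ++ b ++ take (y - q.+1 * K) t.
  rewrite !catA take_cat size_cat sz_s -/K ltnNge -[q * K + K]addnC -mulSn sy //=.
rewrite drop_catl ?sz_s // !prod_word_cat //.
rewrite !mulA -(mulA _ (prod_word mul one _) (label_at _ _ _).1).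
exact: I_mul.
Qed.

(** Between consecutive vertices the infix is a single second component of a letter of [b], outside
    [I]. The bound on block distance is the contrapositive of [mid_val_blocks]. *)
Lemma dc_blocks_adj n G (g := dc one G) :
  represents mul one mid_selector G (flatten (nseq n b)) ->
  [/\ sg_n g = n * size b,
      forall x y : 'I_(sg_n g), y = x.+1 :> nat -> sg_adj x y &
      forall x y : 'I_(sg_n g), sg_adj x y ->
        y %/ size b <= (x %/ size b).+1 /\ x %/ size b <= (y %/ size b).+1].
Proof.
move=> [nE _ _ adjE].
have szE : size (flatten (nseq n b)) = n * size b.
  by rewrite size_flatten /shape map_nseq sumn_nseq mulnC.
have notin : all (fun a => (a.1 == one) && (a.2 \notin I)) (flatten (nseq n b)).
  by elim: (n) => //= m; rewrite all_cat b_notin.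
have lab i : i < n * size b -> (label_at one (flatten (nseq n b)) i).1 = one /\
    (label_at one (flatten (nseq n b)) i).2 \notin I.
  by rewrite -szE => /(all_nthP (one, one) notin)/andP[/eqP].
have sym (x y : 'I_(mlg_n G)) : x < y ->
    (mlg_E x y one one =
      (mid_val mul one (flatten (nseq n b)) x y \notin I)) /\
    mlg_E y x one one = mlg_E x y one one.
  by move=> xy; have [-> ->] := adjE x y xy one one; rewrite !inE.
have lt (x : 'I_(mlg_n G)) : x < n * size b by rewrite -szE -nE.
split=> [|x y yx|]; first by rewrite /= nE szE.
  have xy : x < y by rewrite yx.
  have /negPf xNy : x != y by apply: contraTneq xy => ->; rewrite ltnn.
  rewrite /= xNy (sym _ _ xy).1 /mid_val yx drop_oversize ?size_take_min ?geq_minl //.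
  by rewrite -[prod_word _ _ _]/one mulm1 (lab _ _).1 ?mulm1 ?(lab _ _).2 // -yx.
have main (x y : 'I_(mlg_n G)) : x < y -> mlg_E x y one one ->
    y %/ size b <= (x %/ size b).+1 /\ x %/ size b <= (y %/ size b).+1.
  move=> xy; rewrite (sym _ _ xy).1 => mid; split.
    by rewrite leqNgt; apply: contra mid; apply: mid_val_blocks.
  exact: leqW (leq_div2r _ (ltnW xy)).
move=> x y /=; have [xy|yx|/val_inj ->] := ltngtP x y.
- by case/andP=> _; apply: main.
- by rewrite (sym _ _ yx).2 => /andP[_ /(main _ _ yx)[]].
- by rewrite eqxx.
Qed.

(** An embedding would turn the path through all vertices of [g i] into a walk between the two ends
    of [g j] that moves by at most one block per step, and these ends are too far apart. *)
Lemma blocks_not_2wqo k : 1 < k -> size b = 2 ^ k ->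
  mul (prod_word mul one b) (prod_word mul one b) = prod_word mul one b ->
  ~ k_wqo 2 (dc_Reg_class mul one mid_selector k.+1).
Proof.
move=> k1 sz idem; set K := size b in sz *.
have K1 : 1 < K by rewrite sz -{1}(expn0 2) ltn_exp2l // ltnW.
have [G0 [R0 r0]] := Reg_of_word mid_selector sz.
(* [G i] has [K.+1 ^ i] blocks of [K] vertices, hence fewer vertices than [G j] has blocks when
   [i < j]. *)
pose G i := foldl (mprod mul mid_selector) G0 (nseq (K.+1 ^ i).-1 G0).
have r_pos i : 0 < K.+1 ^ i by rewrite expn_gt0.
have rG i : represents mul one mid_selector (G i) (flatten (nseq (K.+1 ^ i) b)).
  by rewrite -(prednK (r_pos i)); apply: represents_foldl_nseq.
have RG i : Reg mul mid_selector k.+1 (G i).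
  have e0 : mlg_eval G0 = prod_word mul one b by case: r0.
  by apply: (Reg_idem idem R0 e0) => j; rewrite size_nseq nth_nseq => ->.
pose g i := dc one (G i).
(* Marking both extreme vertices with one colour forces ends to go to ends; injectivity makes the
   two images distinct. *)
pose ends i (x : 'I_(sg_n (g i))) := (x == 0 :> nat) || (x == (sg_n (g i)).-1 :> nat).
move=> /(_ _ _ g ends) wqo.
have [||i [j [ij [f [f_inj f_adj f_lab]]]]] := wqo.
- by rewrite card_bool.
- by move=> i; exists (G i).
have [ni path_i _] := dc_blocks_adj (rG i).
have [nj _ adj_j] := dc_blocks_adj (rG j).
rewrite -/(g i) -/(g j) -/K in ni nj path_i adj_j.
have ni1 : 1 < sg_n (g i) by rewrite ni (leq_trans K1) // leq_pmull.
pose x0 := Ordinal (ltnW ni1).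
have walk t (ht : t < sg_n (g i)) :
    f x0 %/ K <= f (Ordinal ht) %/ K + t /\ f (Ordinal ht) %/ K <= f x0 %/ K + t.
  elim: t ht => [|t IHt] ht.
    have -> : Ordinal ht = x0 by apply: val_inj.
    by rewrite addn0.
  have [l1 l2] := IHt (ltnW ht).
  have /adj_j[] : sg_adj (f (Ordinal (ltnW ht))) (f (Ordinal ht)).
    by rewrite f_adj path_i.
  lia.
have last_lt : (sg_n (g i)).-1 < sg_n (g i) by rewrite prednK // ltnW.
have [w1 w2] := walk _ last_lt.
have fx0 : ends j (f x0) by rewrite f_lab /ends eqxx.
have fxl : ends j (f (Ordinal last_lt)) by rewrite f_lab /ends eqxx orbT.
have neq : f x0 != f (Ordinal last_lt) :> nat.
  apply/negP => /eqP/val_inj/f_inj/(congr1 val) E.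
  by have := ni1; rewrite -(prednK (ltnW ni1)) -[_.-1]E.
have divj : (sg_n (g j)).-1 %/ K = (K.+1 ^ j).-1.
  rewrite nj; have -> : (K.+1 ^ j * K).-1 = (K.+1 ^ j).-1 * K + K.-1.
    by have := r_pos j; nia.
  by rewrite divnMDl 1?ltnW // divn_small ?addn0 // prednK // ltnW.
have big : K.+1 ^ j <= K.+1 ^ i * K.
  move: fx0 fxl neq w1 w2; rewrite /ends.
  move=> /orP[]/eqP-> /orP[]/eqP->; rewrite ?eqxx // => _;
    rewrite div0n divj; have := r_pos i; have := r_pos j; lia.
have : K.+1 ^ i.+1 <= K.+1 ^ j by rewrite leq_exp2l // ltnW.
rewrite expnS; have := r_pos i; nia.
Qed.

End LongPaths.

Theorem wqo2_totally_ordered (M : finType) (mul : M -> M -> M) (one : M)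
    (mulA : associative mul) (mul1m : left_id one mul) (mulm1 : right_id one mul) :
  (forall (P : {set M * M * M}) d, k_wqo 2 (dc_Reg_class mul one P d)) ->
  totally_ordered mul.
Proof.
move=> wqo a b; apply: contrapT => /not_orP[Na Nb].
pose I := Jideal mul (mul a b).
(* [I] is contained in the ideals of [a] and of [b], so containing either element would force an
   equality that is excluded. *)
have aI : a \notin I.
  apply/negP => aI; apply: Na; apply/eqP; rewrite eqEsubset.
  by rewrite (Jideal_subl mulA mul1m) (Jideal_sub mulA).
have bI : b \notin I.
  apply/negP => bI; apply: Nb; apply/eqP; rewrite eqEsubset.
  by rewrite (Jideal_subr mulA mulm1) (Jideal_sub mulA).
have I_mul x m y : m \in I -> mul (mul x m) y \in I by apply: Jideal_mul.
(* The padding letters must also lie outside [I]. *)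
have oneI : one \notin I.
  by apply: contra aI => /(I_mul one one a); rewrite !mul1m.
have [n [n0 idem]] := expm_idem mulA mul1m (mul a b).
(* The [n.*2] letters are padded to length [2 ^ n.*2], since [Reg_of_word] takes words whose length
   is a power of two; the padding does not change the value. *)
pose s := flatten (nseq n [:: (one, a); (one, b)]) ++
  nseq (2 ^ n.*2 - n.*2) (one, one).
have sE : prod_word mul one s = iter n (mul (mul a b)) one.
  rewrite prod_word_cat //; have -> m : prod_word mul one (nseq m (one, one)) = one.
    by elim: m => //= m ->; rewrite !mul1m.
  by rewrite mulm1; elim: n {n0 idem s} => //= n ->; rewrite !mul1m mulA.
apply: (@blocks_not_2wqo _ mul one mulA mul1m mulm1 I s I_mul _ _ n.*2) => //.
- rewrite all_cat all_nseq /= eqxx oneI orbT andbT.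
  by elim: (n) => //= m; rewrite eqxx aI bI.
- rewrite sE; case: (n) n0 => // m _.
  have abI := Jideal_refl mul1m mulm1 (mul a b).
  by have := I_mul one _ (iter m (mul (mul a b)) one) abI; rewrite mul1m.
- by rewrite -double0 ltn_Sdouble.
- have le : n.*2 <= 2 ^ n.*2 by rewrite ltnW // ltn_expl.
  rewrite size_cat size_nseq size_flatten /shape map_nseq sumn_nseq /= mul2n; lia.
- by rewrite sE.
Qed.

Theorem theorem4p6 (M : finType) (mul : M -> M -> M) (one : M)
    (mulA : associative mul) (mul1m : left_id one mul) (mulm1 : right_id one mul) :
  (totally_ordered mul <->
     forall (P : {set M * M * M}) (d : nat), inf_wqo (dc_Reg_class mul one P d)) /\
  (totally_ordered mul <->
     forall (P : {set M * M * M}) (d : nat), k_wqo 2 (dc_Reg_class mul one P d)).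
Proof.
split; split.
- by move=> tot P d; apply: totally_ordered_inf_wqo.
- move=> wqo; apply: (wqo2_totally_ordered mulA mul1m mulm1) => P d X _.
  exact: wqo.
- by move=> tot P d X _; apply: totally_ordered_inf_wqo.
- exact: wqo2_totally_ordered.
Qed.
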